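(* Let $q=2^m$ with $m>1$ odd, let $c_1,c_2,c_3,\gamma\in\mathbb{F}_{q^2}$, put $h_1(x)=\mathrm{Tr}_q^{q^2}\bigl(c_1x+c_2x^2+c_3x^3+x^{q+2}\bigr)$, and suppose that $f_1(x)=x+\gamma h_1(x)$ is a permutation polynomial of $\mathbb{F}_{q^2}$. Put $$A=\mathrm{Tr}_q^{q^2}\bigl(c_3\gamma^3+\gamma^{q+2}\bigr),\qquad B(x)=\mathrm{Tr}_q^{q^2}\bigl((c_2+c_3x+x^q)\gamma^2\bigr).$$ Then one of the following four cases holds, and in each case the compositional inverse of $f_1$ on $\mathbb{F}_{q^2}$ is as indicated: (i) if $\gamma=0$, then $f_1^{-1}(x)=x$; (ii) if $\gamma\in\mathbb{F}_q^*$, $c_3=1$ and $\mathrm{Tr}_q^{q^2}(c_2)\neq0$, then $f_1^{-1}(x)=x+\left(\dfrac{h_1(x)}{\mathrm{Tr}_q^{q^2}(c_2)}\right)^{q/2}$; (iii) if $\gamma\in\mathbb{F}_q^*$, $c_3=1$ and $\mathrm{Tr}_q^{q^2}(c_2)=0$, then $f_1^{-1}(x)=x+\dfrac{\gamma\,h_1(x)}{1+\gamma\,\mathrm{Tr}_q^{q^2}(c_1)}$; (iv) if $\gamma\notin\mathbb{F}_q$, $A\neq0$, $\mathrm{Tr}_q^{q^2}(\gamma^2)=(c_3\gamma+\gamma^q)^{q+1}$ and $A\bigl(1+\mathrm{Tr}_q^{q^2}(c_1\gamma)\bigr)=\mathrm{Tr}_q^{q^2}(c_2^2\gamma^4)$,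 then $$f_1^{-1}(x)=x+\frac{\gamma}{A}\Bigl(B(x)+\bigl(B(x)^3+A^2h_1(x)\bigr)^{1/3}\Bigr).$$
   Context: $\mathbb{F}_q$ denotes the finite field with $q$ elements and $\mathbb{F}_q^*=\mathbb{F}_q\setminus\{0\}$. $\mathrm{Tr}_q^{q^2}:\mathbb{F}_{q^2}\to\mathbb{F}_q$ is the relative trace $\mathrm{Tr}_q^{q^2}(x)=x+x^q$. A polynomial $f$ over $\mathbb{F}_{q^2}$ is a permutation polynomial of $\mathbb{F}_{q^2}$ if the map $a\mapsto f(a)$ is a bijection of $\mathbb{F}_{q^2}$; its compositional inverse $f^{-1}$ is the inverse map $\mathbb{F}_{q^2}\to\mathbb{F}_{q^2}$. For $m$ odd, $(\cdot)^{1/3}$ denotes the unique cube root map of $\mathbb{F}_q$, i.e. the inverse of the bijection $t\mapsto t^3$ of $\mathbb{F}_q$. *)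

(* Defs.v *)
From mathcomp Require Import all_boot all_order all_algebra.

Set Implicit Arguments.
Unset Strict Implicit.
Unset Printing Implicit Defensive.

Import GRing.Theory.
Local Open Scope ring_scope.

(* The field with q ^ 2 elements is an arbitrary finFieldType F such that
   #|F| = q ^ 2; its subfield with q elements is the set of roots of X^q - X. *)
Definition Fq (F : finFieldType) (q : nat) : {set F} := [set x | x ^+ q == x].

(* Stated over an arbitrary ring so that it applies both to elements of F and
   to polynomials over F. *)
Definition relTr (R : nzRingType) (q : nat) (x : R) : R := x + x ^+ q.

Definition perm_poly (F : finFieldType) (f : {poly F}) : Prop :=
  bijective (fun a : F => f.[a]).

Definition comp_inverse (F : finFieldType) (f : {poly F}) (g : F -> F) : Prop :=
  cancel (fun a : F => f.[a]) g /\ cancel g (fun a : F => f.[a]).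

(* F itself may contain three cube roots of t, so the root is sought in Fq F q;
   the value is 0 if there is none (which does not happen for t in Fq F q with
   q = 2 ^ m and m odd, see cbrtP below). *)
Definition cbrt (F : finFieldType) (q : nat) (t : F) : F :=
  odflt 0 [pick s in Fq F q | s ^+ 3 == t].

Definition h1 (F : finFieldType) (q : nat) (c1 c2 c3 : F) : {poly F} :=
  relTr q (c1 *: 'X + c2 *: 'X^2 + c3 *: 'X^3 + 'X^(q + 2)).

Definition f1 (F : finFieldType) (q : nat) (c1 c2 c3 gamma : F) : {poly F} :=
  'X + gamma *: h1 q c1 c2 c3.

Lemma horner_h1 (F : finFieldType) (q : nat) (c1 c2 c3 x : F) :
  (h1 q c1 c2 c3).[x] =
    relTr q (c1 * x + c2 * x ^+ 2 + c3 * x ^+ 3 + x ^+ (q + 2)).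
Proof. by rewrite /h1 /relTr !(hornerE, hornerXn). Qed.

Lemma cube_exp (m : nat) : odd m ->
  exists k, (3 * k = (2 ^ m).*2.-1)%N.
Proof.
move=> m_odd; exists (((2 ^ m).*2.-1) %/ 3)%N; rewrite mulnC divnK //.
rewrite -[m]odd_double_half m_odd -mul2n -expnS add1n -doubleS -mul2n expnM.
by rewrite predn_exp dvdn_mulr.
Qed.

Lemma cbrtP (F : finFieldType) (m : nat) (q := (2 ^ m)%N) : odd m ->
  [/\ {in Fq F q, forall t, cbrt q t \in Fq F q},
      {in Fq F q, forall t, cbrt q t ^+ 3 = t}
    & {in Fq F q, forall s, cbrt q (s ^+ 3) = s}].
Proof.
move=> /cube_exp[k kE].
have q_gt0 : (0 < q)%N by rewrite expn_gt0.
have powE (s : F) : s \in Fq F q -> s ^+ (3 * k) = s.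
  rewrite inE => /eqP sq; have [->|s0] := eqVneq s 0.
    by rewrite expr0n kE; move: q_gt0; rewrite /q; case: (2 ^ m)%N.
  apply: (mulfI s0); rewrite -exprS kE prednK ?double_gt0 // -/q.
  by rewrite -addnn exprD sq.
have cbrtE t : t \in Fq F q -> cbrt q t \in Fq F q /\ cbrt q t ^+ 3 = t.
  move=> tF; rewrite /cbrt; case: pickP => [s /andP[sF /eqP s3]|/(_ (t ^+ k))] //.
  rewrite -exprM mulnC powE // eqxx andbT => /negP[].
  by move: tF; rewrite !inE -exprM mulnC exprM => /eqP->.
split=> [t /cbrtE[]|t /cbrtE[]|s sF] //.
have s3F : s ^+ 3 \in Fq F q.
  by move: sF; rewrite !inE -exprM mulnC exprM => /eqP->.
have [cF c3] := cbrtE _ s3F.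
by rewrite -[LHS]powE // exprM c3 -exprM powE.
Qed.

(* Main.v *)
Require Import Defs.
From mathcomp Require Import all_boot all_order all_algebra.
From mathcomp Require Import finfield ring.

Set Implicit Arguments.
Unset Strict Implicit.
Unset Printing Implicit Defensive.

Import GRing.Theory.
Local Open Scope ring_scope.

(** The polynomial f = X + gamma h1 maps each line x + gamma F_q into itself,
since h1 takes its values in F_q. Along such a line f is a cubic in the
parameter: for t in F_q,
  f(x + gamma t) = x + gamma (h1(x) + C(x) t + B(x) t^2 + A t^3),
with A constant and B(x), C(x) in F_q affine in x and in x^2 (lemma f1_line).
For gamma <> 0, f is thus a permutation exactly when, for every x, the cubic
P_x(t) = C(x) t + B(x) t^2 + A t^3 is injective on F_q, and the inverse of f
sends x to x + gamma t where t is the solution of P_x(t) = h1(x) (lemma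
inverse_of_line_root, where characteristic 2 spares a sign).

If A <> 0, put b = B(x) / A. In characteristic 2,
  P_x(b + t) - P_x(b) = A t (t^2 + r^2),  with A r^2 = C(x) + A b^2,
where r exists in F_q because every element of F_q is a square. Injectivity
forces r = 0, that is A C(x) = B(x)^2 for all x (lemma lineC_sqr). At x = 0 this
is the condition relating c1 and c2; comparing the parts that vary with x, by
nondegeneracy of the trace, gives the norm condition (relTr_gamma_sqr), which in
turn excludes gamma in F_q. Then A^2 P_x(t) = (A t + B(x))^3 + B(x)^3, and a cube
root solves P_x(t) = h1(x).

If A = 0, then P_x(t) = t (C(x) + B(x) t) is injective exactly when one and only
one of B(x), C(x) vanishes (lemma line_additive). If one of B, C depended on x,
both would vanish or neither would for some x, as F_q has more than two elements
(lemma slopes_eq0). So B and C are constant, which means gamma in F_q and c3 = 1,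
and P_x(t) = h1(x) is solved by a square root (C = 0) or by a division (B = 0). *)

(** * The cubic along a line of direction gamma *)

Definition lineA (F : finFieldType) (q : nat) (c3 g : F) : F :=
  relTr q (c3 * g ^+ 3 + g ^+ (q + 2)).

Definition lineB (F : finFieldType) (q : nat) (c2 c3 g x : F) : F :=
  relTr q ((c2 + c3 * x + x ^+ q) * g ^+ 2).

Definition lineC (F : finFieldType) (q : nat) (c1 c3 g x : F) : F :=
  1 + relTr q (c1 * g) + relTr q ((c3 * g + g ^+ q) * x ^+ 2).

(** * Arithmetic of the quadratic extension *)

Section QuadraticExtension.

Variables (m q : nat) (F : finFieldType).
Hypotheses (m_gt1 : (1 < m)%N) (qE : q = (2 ^ m)%N) (cardF : #|F| = (q ^ 2)%N).

Implicit Types a b c g s t u v w x y : F.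

Lemma pchar2 : 2%N \in [pchar F].
Proof.
by apply: (@card_finPcharP _ _ (m * 2)) => //; rewrite cardF qE expnM.
Qed.

Lemma two_eq0 : 2%:R = 0 :> F.
Proof. exact: pcharf0 pchar2. Qed.

(** The normalization of ring can only erase a monomial whose coefficient is
literally one of the constants known to be zero, so 4 and 6 are needed beside 2.
*)
Lemma even_eq0 n : (n.*2)%:R = 0 :> F.
Proof. by rewrite -muln2 natrM two_eq0 mulr0. Qed.

(** Turns an identity of characteristic 2 into one where every coefficient is a
nonnegative even integer. *)
Lemma add_eq0_eq x y : x + y = 0 -> x = y.
Proof. by move/eqP; rewrite addr_eq0 (oppr_pchar2 pchar2) => /eqP. Qed.

Lemma conjD x y : (x + y) ^+ q = x ^+ q + y ^+ q.
Proof. by rewrite exprDn_pchar // qE pnatX pnatE ?pchar2. Qed.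

Lemma conjK x : x ^+ q ^+ q = x.
Proof. by rewrite -exprM -[(q * q)%N]/(q ^ 2)%N -cardF expf_card. Qed.

Lemma half_q : (q %/ 2 * 2 = q)%N.
Proof. by rewrite divnK // qE dvdn_exp // ltnW. Qed.

Lemma q_ge4 : (4 <= q)%N.
Proof. by rewrite qE (@leq_pexp2l 2 2). Qed.

Lemma conj0 : 0 ^+ q = 0 :> F.
Proof. by rewrite expr0n qE expn_eq0. Qed.

Lemma q_add3_le : (q + 3 <= q ^ 2)%N.
Proof.
apply: (@leq_trans (q * 2)%N); last first.
  by rewrite -mulnn leq_mul // (leq_trans _ q_ge4).
by rewrite muln2 -addnn leq_add2l (leq_trans _ q_ge4).
Qed.

Lemma FqP x : reflect (x ^+ q = x) (x \in Fq F q).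
Proof. by rewrite inE; apply: eqP. Qed.

Lemma Fq0 : 0 \in Fq F q.
Proof. by apply/FqP; rewrite conj0. Qed.

Lemma Fq1 : 1 \in Fq F q.
Proof. by apply/FqP; rewrite expr1n. Qed.

Lemma FqD x y : x \in Fq F q -> y \in Fq F q -> x + y \in Fq F q.
Proof. by move=> /FqP xq /FqP yq; apply/FqP; rewrite conjD xq yq. Qed.

Lemma FqM x y : x \in Fq F q -> y \in Fq F q -> x * y \in Fq F q.
Proof. by move=> /FqP xq /FqP yq; apply/FqP; rewrite exprMn xq yq. Qed.

Lemma FqX x n : x \in Fq F q -> x ^+ n \in Fq F q.
Proof. by move=> /FqP xq; apply/FqP; rewrite exprAC xq. Qed.

Lemma FqV x : x \in Fq F q -> x^-1 \in Fq F q.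
Proof. by move=> /FqP xq; apply/FqP; rewrite exprVn xq. Qed.

Lemma relTr_Fq x : relTr q x \in Fq F q.
Proof. by apply/FqP; rewrite /relTr conjD conjK addrC. Qed.

Lemma relTrD x y : relTr q (x + y) = relTr q x + relTr q y.
Proof. by rewrite /relTr conjD addrACA. Qed.

Lemma relTrZ s x : s \in Fq F q -> relTr q (s * x) = s * relTr q x.
Proof. by move=> /FqP sq; rewrite /relTr exprMn sq mulrDr. Qed.

Lemma relTr_sqr x : relTr q (x ^+ 2) = relTr q x ^+ 2.
Proof. by rewrite /relTr exprAC exprDn_pchar ?pnatE ?pchar2. Qed.

Lemma relTr0 : relTr q (0 : F) = 0.
Proof. by rewrite /relTr conj0 addr0. Qed.

Lemma exists_sqrt x : exists y, y ^+ 2 = x.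
Proof.
by exists (x ^+ (q * (q %/ 2))); rewrite -exprM -mulnA half_q exprM conjK.
Qed.

Lemma Fq_sqrtK s : s \in Fq F q -> (s ^+ (q %/ 2)) ^+ 2 = s.
Proof. by move=> /FqP sq; rewrite -exprM half_q. Qed.

Lemma exists_nonroot (p : {poly F}) :
  p != 0 -> (size p <= q ^ 2)%N -> exists x, p.[x] != 0.
Proof.
move=> p0 sz; apply/existsP; apply: contraLR sz.
rewrite negb_exists -ltnNge -cardF cardE => /forallP px0.
apply: max_poly_roots => //; last exact: enum_uniq.
by apply/allP => x _; apply/rootP/eqP; have := px0 x; rewrite negbK.
Qed.

(** The trace is F_q-linear, so it is onto F_q as soon as it is nonzero; it is
nonzero because it is a polynomial of degree q < q^2. *)
Lemma relTr_surj b s :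
  b != 0 -> s \in Fq F q -> exists v, relTr q (b * v) = s.
Proof.
move=> b0 sF; have q4 := q_ge4.
have szp : size ('X^q + 'X : {poly F}) = q.+1.
  by rewrite size_polyDl size_polyXn // size_polyX ltnS (leq_trans _ q4).
have [||w] := @exists_nonroot ('X^q + 'X).
- by rewrite -size_poly_gt0 szp.
- by rewrite szp (leq_trans _ q_add3_le) // addn3 !ltnS leqW.
rewrite hornerD hornerXn hornerX addrC -/(relTr q w) => w0.
exists (b^-1 * (s / relTr q w * w)).
rewrite mulrA divff // mul1r relTrZ ?divfK //.
by rewrite FqM // FqV // relTr_Fq.
Qed.

(** The squares v^2 exhaust the field, so this is nondegeneracy of the trace form,
in the shape given by the quadratic dependence of C(x) on x. *)
Lemma relTr_nondeg b : (forall v, relTr q (b * v ^+ 2) = 0) -> b = 0.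
Proof.
move=> tr0; apply/eqP; apply: contraT => b0.
have [v trv] := relTr_surj b0 Fq1; have [y yE] := exists_sqrt v.
by have := tr0 y; rewrite yE trv => /eqP; rewrite oner_eq0.
Qed.

(** The element is a norm x^(q+1): if norms took only the values 0 and 1, every
element of the field would be a root of X^(q+2) - X. *)
Lemma Fq_third : exists t, [/\ t \in Fq F q, t != 0 & t != 1].
Proof.
have q4 := q_ge4.
have szp : size ('X^(q + 2) - 'X : {poly F}) = (q + 3)%N.
  by rewrite addn3 addn2 size_polyDl ?size_polyN !size_polyXn ?size_polyX.
have [||x] := @exists_nonroot ('X^(q + 2) - 'X).
- by rewrite -size_poly_gt0 szp addnS.
- by rewrite szp q_add3_le.
rewrite hornerD hornerN hornerXn hornerX subr_eq0 addn2 exprS => Nx.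
exists (x ^+ q.+1); split.
- by apply/FqP; rewrite exprAC exprS conjK -exprSr.
- by apply: contra Nx; rewrite expf_eq0 => /andP[_ /eqP->]; rewrite mul0r.
- by apply: contra Nx => /eqP->; rewrite mulr1.
Qed.

(** * Restriction of f to lines *)

Variables (c1 c2 c3 gamma : F).

Local Notation f := (f1 q c1 c2 c3 gamma).
Local Notation h := (h1 q c1 c2 c3).
Local Notation A := (lineA q c3 gamma).
Local Notation B := (lineB q c2 c3 gamma).
Local Notation C := (lineC q c1 c3 gamma).
Local Notation P x t := (C x * t + B x * t ^+ 2 + A * t ^+ 3).
Local Notation slopeB := (c3 * gamma ^+ 2 + gamma ^+ q ^+ 2).
Local Notation slopeC := (c3 * gamma + gamma ^+ q).

Lemma horner_f1 x : f.[x] = x + gamma * h.[x].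
Proof. by rewrite /f1 !hornerE. Qed.

Lemma horner_h1_Fq x : h.[x] \in Fq F q.
Proof. by rewrite horner_h1 relTr_Fq. Qed.

(** Third-order Taylor expansion of h1 at x in the direction gamma t; conjugation
fixes t, so the traces of the coefficients come out as A, B(x), C(x). The leading
1 in C(x) accounts for the summand gamma t. *)
Lemma f1_line x t : t \in Fq F q ->
  f.[x + gamma * t] = x + gamma * (h.[x] + P x t).
Proof.
move=> /FqP tq; rewrite horner_f1 !horner_h1 -[LHS]addrA; congr (x + _).
rewrite -mulrDr; congr (gamma * _).
rewrite /lineA /lineB /lineC /relTr !(exprD _ q 2).
rewrite !(conjD, exprMn, conjK, tq).
(* The identity holds with the conjugates as independent variables. *)
move: (x ^+ q) (gamma ^+ q) (c1 ^+ q) (c2 ^+ q) (c3 ^+ q) => X G C1 C2 C3.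
apply: add_eq0_eq.
by ring: two_eq0 (even_eq0 2 : 4%:R = 0).
Qed.

(** The equation to solve is P_x(t) = - h1(x); the sign disappears in
characteristic 2. A right inverse of an injection is its inverse. *)
Lemma inverse_of_line_root (g tau : F -> F) :
    injective (fun x => f.[x]) ->
    (forall x, g x = x + gamma * tau x) ->
    (forall x, tau x \in Fq F q) ->
    (forall x, P x (tau x) = h.[x]) ->
  comp_inverse f g.
Proof.
move=> f_inj gE tauF tauP.
have fgK : cancel g (fun x => f.[x]).
  move=> x; rewrite gE f1_line // tauP.
  by rewrite (addrr_pchar2 pchar2) mulr0 addr0.
by split=> //; exact: inj_can_sym fgK f_inj.
Qed.

Lemma lineB_affine x v :
  B (x + v) = B x + relTr q (slopeB * v).
Proof.
rewrite /lineB /relTr.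
rewrite !(conjD, exprMn, conjK).
move: (x ^+ q) (gamma ^+ q) (v ^+ q) (c2 ^+ q) (c3 ^+ q) => X G V C2 C3.
by ring.
Qed.

Lemma lineC_affine x v :
  C (x + v) = C x + relTr q (slopeC * v ^+ 2).
Proof.
by rewrite /lineC exprDn_pchar ?pnatE ?pchar2 // mulrDr relTrD addrA.
Qed.

(** * Consequences of injectivity along lines *)

Section Permutation.

Hypothesis gamma_neq0 : gamma != 0.
Hypothesis f_inj : injective (fun x => f.[x]).

Lemma lineA_Fq : A \in Fq F q. Proof. exact: relTr_Fq. Qed.
Lemma lineB_Fq x : B x \in Fq F q. Proof. exact: relTr_Fq. Qed.
Lemma lineC_Fq x : C x \in Fq F q.
Proof. exact: (FqD (FqD Fq1 (relTr_Fq _)) (relTr_Fq _)). Qed.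

Lemma line_inj x s t :
  s \in Fq F q -> t \in Fq F q -> P x s = P x t -> s = t.
Proof.
move=> sF tF Pst; apply: (mulfI gamma_neq0); apply: (addrI x).
by apply: f_inj; rewrite !f1_line // Pst.
Qed.

(** With b = B(x) / A and C(x) = A (r^2 + b^2), the cubic P_x takes the same value
at b + r and at b, so injectivity forces r = 0. *)
Lemma lineC_sqr x : A != 0 -> A * C x = B x ^+ 2.
Proof.
move=> A0.
have AVF : A^-1 \in Fq F q by rewrite FqV ?lineA_Fq.
have [b bF BE] : exists2 b, b \in Fq F q & B x = A * b.
  by exists (B x / A); rewrite ?FqM ?lineB_Fq // mulrC divfK.
have [r rF CE] : exists2 r, r \in Fq F q & C x = A * (r ^+ 2 + b ^+ 2).
  have eF : C x / A + b ^+ 2 \in Fq F q by rewrite FqD ?FqX ?FqM ?lineC_Fq.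
  exists ((C x / A + b ^+ 2) ^+ (q %/ 2)); first exact: FqX.
  rewrite Fq_sqrtK // -addrA (addrr_pchar2 pchar2) addr0.
  by rewrite mulrC divfK.
have r0 : b + r = b + 0.
  apply: (@line_inj x); rewrite ?FqD ?Fq0 //.
  rewrite addr0 CE BE; move: A => a; apply: add_eq0_eq.
  by ring: two_eq0 (even_eq0 2 : 4%:R = 0) (even_eq0 3 : 6%:R = 0).
by rewrite CE BE (addrI _ r0); move: A => a; ring.
Qed.

(** P_x(t) = t (C(x) + B(x) t) is additive in t: its kernel is everything if
B(x) = C(x) = 0, and contains the nonzero element C(x) / B(x) if both are
nonzero. *)
Lemma line_additive x : A = 0 -> (B x == 0) = (C x != 0).
Proof.
move=> A0; have PE t : P x t = (C x + B x * t) * t.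
  by rewrite A0; ring.
have [B0|B0] := eqVneq (B x) 0.
  apply/esym; apply/negP => /eqP C0.
  have := @line_inj x 1 0 Fq1 Fq0.
  by rewrite !PE B0 C0 !(mul0r, addr0) => /(_ erefl) /eqP; rewrite oner_eq0.
apply/esym/negbTE; rewrite negbK.
have /eqP : C x / B x = 0.
  apply: (@line_inj x); rewrite ?Fq0 ?FqM ?FqV ?lineB_Fq ?lineC_Fq //.
  rewrite !PE mulr0 mulrC -[B x * _]mulrC divfK //.
  by rewrite (addrr_pchar2 pchar2) mulr0.
by rewrite mulf_eq0 invr_eq0 (negbTE B0) orbF.
Qed.

Lemma lineA_factor : A = gamma ^+ 2 * slopeC + gamma ^+ q ^+ 2 * slopeC ^+ q.
Proof.
rewrite /lineA /relTr (exprD _ q 2) !(conjD, exprMn, conjK).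
by move: (gamma ^+ q) (c3 ^+ q) => G C3; ring.
Qed.

(** A C(x) = B(x)^2 holds for all x; subtracting its instance at 0 leaves the
identity of traces Tr(A slopeC v^2) = Tr((slopeB v)^2) for all v. *)
Lemma lineA_slopeC : A != 0 -> A * slopeC = slopeB ^+ 2.
Proof.
move=> A0; apply: add_eq0_eq; apply: relTr_nondeg => v.
rewrite mulrDl relTrD -[A * slopeC * _]mulrA relTrZ ?lineA_Fq //.
rewrite -exprMn relTr_sqr.
have := lineC_sqr (0 + v) A0; rewrite lineC_affine lineB_affine mulrDr.
rewrite exprDn_pchar ?pnatE ?pchar2 // lineC_sqr // => /addrI ->.
by rewrite (addrr_pchar2 pchar2).
Qed.

(** Expanding A slopeC = slopeB^2 by lineA_factor, with u = slopeC and
G = gamma^q, the difference of the two sides is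
G^2 (u u^q + gamma^2 + G^2). *)
Lemma relTr_gamma_sqr : A != 0 -> relTr q (gamma ^+ 2) = slopeC ^+ (q + 1).
Proof.
move=> A0; have G0 : gamma ^+ q ^+ 2 != 0 by rewrite !expf_neq0.
apply: add_eq0_eq; apply: (mulfI G0); rewrite mulr0.
have := lineA_slopeC A0; rewrite lineA_factor => E.
transitivity ((gamma ^+ 2 * slopeC + gamma ^+ q ^+ 2 * slopeC ^+ q) * slopeC
              + slopeB ^+ 2).
  2: by rewrite E (addrr_pchar2 pchar2).
rewrite (exprD _ q 1) expr1 /relTr (exprAC _ 2 q).
move: (slopeC ^+ q) (gamma ^+ q) => U G; apply: add_eq0_eq.
by ring: two_eq0 (even_eq0 2 : 4%:R = 0).
Qed.

(** For gamma in F_q the trace of gamma^2 is 2 gamma^2 = 0, so slopeC vanishes by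
relTr_gamma_sqr, and with it A. *)
Lemma gamma_notin_Fq : A != 0 -> gamma \notin Fq F q.
Proof.
move=> A0; apply: contra (A0) => gF.
have := relTr_gamma_sqr A0; rewrite /relTr (FqP _ (FqX _ gF)).
rewrite (addrr_pchar2 pchar2) => /esym /eqP.
rewrite expf_eq0 => /andP[_ /eqP slopeC0].
by rewrite lineA_factor slopeC0 conj0 !mulr0 addr0.
Qed.

(** If slopeB <> 0, then on a line a + t v with B(a + t v) = t, the function C must
vanish for t <> 0 but not at t = 0. Since C(a + t v) = C(a) + t^2 k with k
constant, this gives C(a) = t^2 k for all t <> 0 in F_q, impossible when F_q has
an element other than 0 and 1. If slopeB = 0 and slopeC <> 0, then B is constant
while C takes both the values 0 and 1. *)
Lemma slopes_eq0 : A = 0 -> slopeB = 0 /\ slopeC = 0.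
Proof.
move=> A0; have BC x := line_additive x A0.
have slopeB0 : slopeB = 0.
  apply/eqP; apply: contraT => b0.
  have [v trv] := relTr_surj b0 Fq1.
  have [a trb] := relTr_surj b0 (lineB_Fq 0).
  have Ba : B a = 0.
    by rewrite -[a]add0r lineB_affine trb (addrr_pchar2 pchar2).
  have Ca0 : C a != 0 by rewrite -BC Ba.
  have CaE t : t \in Fq F q -> t != 0 ->
      C a = t ^+ 2 * relTr q (slopeC * v ^+ 2).
    move=> tF t0; apply: add_eq0_eq; rewrite -relTrZ ?FqX //.
    have -> : t ^+ 2 * (slopeC * v ^+ 2) = slopeC * (t * v) ^+ 2 by ring.
    rewrite -lineC_affine; apply/eqP; rewrite -[_ == _]negbK -BC.
    by rewrite lineB_affine Ba add0r mulrCA relTrZ // trv mulr1.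
  have [t [tF t0 t1]] := Fq_third.
  have Ct := CaE t tF t0; have := CaE 1 Fq1 (oner_neq0 _).
  rewrite expr1n mul1r => C1; move: Ct; rewrite -C1 -{1}[C a]mul1r.
  move/(mulIf Ca0)/esym/eqP; rewrite sqrf_eq1 (oppr_pchar2 pchar2) orbb.
  by rewrite (negbTE t1).
split=> //; apply/eqP; apply: contraT => slopeC0.
have Bconst x : B x = B 0.
  by rewrite -[x]add0r lineB_affine slopeB0 mul0r relTr0 addr0.
have Cval s : s \in Fq F q -> exists x, C x = s.
  move=> sF; have [|v trv] := @relTr_surj slopeC (s + C 0) slopeC0.
    by rewrite FqD // lineC_Fq.
  have [y yE] := exists_sqrt v; exists y.
  rewrite -[y]add0r lineC_affine yE trv addrCA.
  by rewrite (addrr_pchar2 pchar2) addr0.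
have [x Cx] := Cval 0 Fq0; have [y Cy] := Cval 1 Fq1.
by have := BC x; rewrite Cx Bconst -(Bconst y) BC Cy eqxx oner_eq0.
Qed.

(** slopeC = 0 means gamma^q = c3 gamma; then slopeB = 0 reads
gamma^q (gamma + gamma^q) = 0. *)
Lemma gamma_Fq_of_slopes_eq0 :
  slopeB = 0 -> slopeC = 0 -> gamma \in Fq F q /\ c3 = 1.
Proof.
move=> b0 slopeC0.
have gqE : gamma ^+ q = c3 * gamma by apply/esym/add_eq0_eq.
have g0 : gamma ^+ q != 0 by rewrite expf_neq0.
have gF : gamma ^+ q = gamma.
  apply: (mulfI g0); apply: add_eq0_eq; rewrite -b0 [X in _ + X]mulrC gqE.
  by ring.
split; first exact/FqP.
by apply: (mulIf gamma_neq0); rewrite -gqE mul1r.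
Qed.

(** * The inverses *)

Lemma line_coefs_Fq : gamma \in Fq F q -> c3 = 1 ->
  [/\ A = 0, forall x, B x = gamma ^+ 2 * relTr q c2
    & forall x, C x = 1 + gamma * relTr q c1].
Proof.
move=> gF c31; have /FqP gq := gF.
have xx0 := addrr_pchar2 pchar2.
have A0 : A = 0 by rewrite lineA_factor c31 gq mul1r xx0 conj0 !mulr0 addr0.
split=> // x; rewrite -[x]add0r ?lineB_affine ?lineC_affine c31 gq !mul1r xx0.
  by rewrite mul0r relTr0 addr0 /lineB mulr0 conj0 !addr0 mulrC relTrZ ?FqX.
by rewrite mul0r relTr0 addr0 /lineC expr0n mulr0 relTr0 addr0 mulrC relTrZ.
Qed.

(** B is a nonzero constant, so C = 0 by line_additive and the equation to solve is
gamma^2 Tr(c2) t^2 = h1(x); the power q / 2 is the square root of F_q. *)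
Lemma inverse_sqrt :
    gamma \in Fq F q -> c3 = 1 -> relTr q c2 != 0 ->
  comp_inverse f (fun x => x + (h.[x] / relTr q c2) ^+ (q %/ 2)).
Proof.
move=> gF c31 trc2; have [A0 BE CE] := line_coefs_Fq gF c31.
have tF x : (h.[x] / relTr q c2) ^+ (q %/ 2) \in Fq F q.
  by rewrite FqX // FqM ?FqV ?horner_h1_Fq ?relTr_Fq.
apply: (inverse_of_line_root (tau := fun x =>
  (h.[x] / relTr q c2) ^+ (q %/ 2) / gamma)) => // x.
- by rewrite [gamma * _]mulrC divfK.
- by rewrite FqM // FqV.
have C0 : C x = 0.
  apply/eqP; rewrite -[_ == _]negbK -line_additive // BE.
  by rewrite mulf_neq0 // expf_neq0.
rewrite A0 C0 !mul0r add0r addr0 BE expr_div_n Fq_sqrtK; last first.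
  by rewrite FqM ?FqV ?horner_h1_Fq ?relTr_Fq.
by field; rewrite gamma_neq0.
Qed.

(** Here B = 0, so C is nonzero by line_additive and the equation to solve is
C t = h1(x). *)
Lemma inverse_linear :
    gamma \in Fq F q -> c3 = 1 -> relTr q c2 = 0 ->
  comp_inverse f (fun x => x + gamma * h.[x] / (1 + gamma * relTr q c1)).
Proof.
move=> gF c31 trc2; have [A0 BE CE] := line_coefs_Fq gF c31.
have C0 : 1 + gamma * relTr q c1 != 0.
  by rewrite -(CE 0) -line_additive // BE trc2 mulr0.
apply: (inverse_of_line_root (tau := fun x =>
  h.[x] / (1 + gamma * relTr q c1))) => // x.
- by rewrite mulrA.
- by rewrite FqM ?horner_h1_Fq // FqV // FqD ?Fq1 // FqM // relTr_Fq.
by rewrite A0 BE trc2 CE mulr0 !mul0r !addr0 mulrC divfK.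
Qed.

(** Since A C(x) = B(x)^2, the equation P_x(t) = h1(x) multiplied by A^2 is
(A t + B(x))^3 = B(x)^3 + A^2 h1(x). *)
Lemma inverse_cbrt : odd m -> A != 0 ->
  comp_inverse f (fun x =>
    x + gamma / A * (B x + cbrt q (B x ^+ 3 + A ^+ 2 * h.[x]))).
Proof.
move=> m_odd A0; have := cbrtP F m_odd; rewrite -qE => -[cF c3E _].
have argF x : B x ^+ 3 + A ^+ 2 * h.[x] \in Fq F q.
  by rewrite FqD ?FqM ?FqX ?horner_h1_Fq ?lineA_Fq ?lineB_Fq.
apply: (inverse_of_line_root (tau := fun x =>
  (B x + cbrt q (B x ^+ 3 + A ^+ 2 * h.[x])) / A)) => // x.
- by rewrite -mulrA [A^-1 * _]mulrC.
- by rewrite FqM ?FqV ?lineA_Fq // FqD ?lineB_Fq // cF.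
have CE : C x = B x ^+ 2 / A by rewrite -lineC_sqr // mulrC mulKf.
have := c3E _ (argF x); move: (cbrt q _) => s sE.
have hE : h.[x] = (s ^+ 3 + B x ^+ 3) / A ^+ 2.
  by rewrite sE addrC addrA (addrr_pchar2 pchar2) add0r mulrC mulKf ?expf_neq0.
rewrite hE CE; move: A A0 (B x) => a a0 b; apply: add_eq0_eq.
(* The equation holds up to this explicit multiple of 2. *)
have -> : b ^+ 2 / a * ((b + s) / a) + b * ((b + s) / a) ^+ 2 +
    a * ((b + s) / a) ^+ 3 + (s ^+ 3 + b ^+ 3) / a ^+ 2 =
  2%:R * ((2%:R * b ^+ 3 + 3%:R * b ^+ 2 * s + 2%:R * b * s ^+ 2 + s ^+ 3)
          / a ^+ 2).
  by field.
by rewrite two_eq0 mul0r.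
Qed.

End Permutation.
End QuadraticExtension.

Theorem theorem4p2 (m q : nat) (m_gt1 : (1 < m)%N) (m_odd : odd m)
    (qE : q = (2 ^ m)%N) (F : finFieldType) (cardF : #|F| = (q ^ 2)%N)
    (c1 c2 c3 gamma : F) (f1_perm : perm_poly (f1 q c1 c2 c3 gamma)) :
  let f := f1 q c1 c2 c3 gamma in
  let h (x : F) := (h1 q c1 c2 c3).[x] in
  let A := relTr q (c3 * gamma ^+ 3 + gamma ^+ (q + 2)) in
  let B (x : F) := relTr q ((c2 + c3 * x + x ^+ q) * gamma ^+ 2) in
  let case1 := gamma = 0 in
  let case2 := [/\ gamma \in Fq F q, gamma != 0, c3 = 1 & relTr q c2 != 0] in
  let case3 := [/\ gamma \in Fq F q, gamma != 0, c3 = 1 & relTr q c2 = 0] in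
  let case4 := [/\ gamma \notin Fq F q, A != 0,
                   relTr q (gamma ^+ 2) = (c3 * gamma + gamma ^+ q) ^+ (q + 1)
                 & A * (1 + relTr q (c1 * gamma))
                   = relTr q (c2 ^+ 2 * gamma ^+ 4)] in
  [/\ [\/ case1, case2, case3 | case4],
      case1 -> comp_inverse f (fun x => x),
      case2 ->
        comp_inverse f (fun x => x + (h x / relTr q c2) ^+ (q %/ 2)),
      case3 ->
        comp_inverse f (fun x => x + gamma * h x / (1 + gamma * relTr q c1))
    & case4 ->
        comp_inverse f (fun x =>
          x + gamma / A * (B x + cbrt q (B x ^+ 3 + A ^+ 2 * h x)))].
Proof.
move=> f h A B case1 case2 case3 case4.
have f_inj : injective (fun x => f.[x]) := bij_inj f1_perm.
split.
- have [g0|g0] := eqVneq gamma 0; first by constructor 1.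
  have [A0|A0] := eqVneq A 0.
    have [slopeB0 slopeC0] := slopes_eq0 m_gt1 qE cardF g0 f_inj A0.
    have [gF c31] := gamma_Fq_of_slopes_eq0 qE cardF g0 slopeB0 slopeC0.
    by have [tr0|tr0] := eqVneq (relTr q c2) 0; [constructor 3|constructor 2].
  constructor 4; split=> //.
  + exact: (gamma_notin_Fq m_gt1 qE cardF g0 f_inj A0).
  + exact: (relTr_gamma_sqr m_gt1 qE cardF g0 f_inj A0).
  + have := lineC_sqr m_gt1 qE cardF g0 f_inj 0 A0.
    rewrite /lineC /lineB expr0n !mulr0 (conj0 _ qE).
    rewrite (relTr0 _ qE) !addr0 => ->.
    by rewrite -(relTr_sqr qE cardF) exprMn -exprM.
- by rewrite /case1 => g0; split=> x; rewrite /= /f horner_f1 g0 mul0r addr0.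
- by case=> gF g0 c31 trc2; apply: (inverse_sqrt m_gt1 qE cardF).
- by case=> gF g0 c31 trc2; apply: (inverse_linear qE cardF).
case=> gF A0 _ _; apply: (inverse_cbrt m_gt1 qE cardF) => //.
by apply: contraNneq gF => ->; rewrite (Fq0 _ qE).
Qed.
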